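(* Let $X\subset\mathbb{R}^{d_1}$ and $Y\subset\mathbb{R}^{d_2}$ be nonempty convex compact sets. Let $\{\bar{\mathcal{L}}_t\}_{t=1}^T$ be any sequence of convex-concave functions $\bar{\mathcal L}_t:X\times Y\to\mathbb{R}$, each $G_{\bar{\mathcal{L}}}$-Lipschitz with respect to a norm $\|\cdot\|$. Let $R_X:X\to[0,\infty)$ and $R_Y:Y\to[0,\infty)$ be $1$-strongly convex with respect to $\|\cdot\|$ and Lipschitz with respect to $\|\cdot\|$ with constants $G_{R_X}$ and $G_{R_Y}$ respectively, and let $\eta>0$. Let $\{(x_t,y_t)\}_{t=1}^T$ be the iterates generated by the algorithm SP-RFTL with parameters $\eta,R_X,R_Y$ run on $\{\bar{\mathcal{L}}_t\}_{t=1}^T$. Then $$\Bigl|\sum_{t=1}^T\bar{\mathcal{L}}_t(x_t,y_t)-\min_{x\in X}\max_{y\in Y}\sum_{t=1}^T\bar{\mathcal{L}}_t(x,y)\Bigr|\le 8\eta\Bigl[G_{\bar{\mathcal{L}}}+\tfrac1\eta\max(G_{R_X},G_{R_Y})\Bigr]^2(1+\ln T)+\frac T\eta\max_{y\in Y}R_Y(y)+\frac T\eta\max_{x\in X}R_X(x).$$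
   Context: Norm convention: $\|\cdot\|$ is a norm on $\mathbb{R}^{d_1+d_2}$, and for $x\in\mathbb{R}^{d_1}$, $y\in\mathbb{R}^{d_2}$ one writes $\|x\|=\|[x;0]\|$, $\|y\|=\|[0;y]\|$, where $[x;y]$ denotes concatenation. Convex-concave: convex in $x\in X$ for each fixed $y\in Y$ and concave in $y\in Y$ for each fixed $x\in X$. $G$-Lipschitz: $|\mathcal{L}(x_1,y_1)-\mathcal{L}(x_2,y_2)|\le G\|[x_1;y_1]-[x_2;y_2]\|$. $f$ is $H$-strongly convex w.r.t. $\|\cdot\|$ if $f(x_1)\ge f(x_2)+\nabla f(x_2)^\top(x_1-x_2)+\frac H2\|x_1-x_2\|^2$ for all $x_1,x_2$, with $\nabla f$ a subgradient. SP-RFTL (Saddle-Point Regularized-Follow-the-Leader): start with arbitrary $x_1\in X$, $y_1\in Y$; for $t\ge1$, after $\bar{\mathcal{L}}_t$ is revealed, put $\mathcal{L}_t(x,y)=\bar{\mathcal{L}}_t(x,y)+\frac1\eta R_X(x)-\frac1\eta R_Y(y)$ and set $x_{t+1}=\arg\min_{x\in X}\max_{y\in Y}\sum_{\tau=1}^t\mathcal{L}_\tau(x,y)$, $y_{t+1}=\arg\max_{y\in Y}\min_{x\in X}\sum_{\tau=1}^t\mathcal{L}_\tau(x,y)$. *)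

(* Defs.v *)
From HB Require Import structures.
From mathcomp Require Import all_boot all_order all_algebra.
From mathcomp Require Import all_classical all_reals all_analysis.

Set Implicit Arguments.
Unset Strict Implicit.
Unset Printing Implicit Defensive.

Import Order.TTheory GRing.Theory Num.Theory.
Import numFieldNormedType.Exports.

Local Open Scope classical_set_scope.
Local Open Scope ring_scope.

(* [N] is an arbitrary norm, unrelated to the (sup) norm that the library puts
   canonically on matrices.  The latter is used only for the topology, which in
   finite dimension does not depend on the norm. *)
Record is_norm (R : realType) (n : nat) (N : 'rV[R]_n -> R) : Prop := IsNorm {
  is_norm_triangle : forall u v, N (u + v) <= N u + N v;
  is_normZ : forall (a : R) u, N (a *: u) = `|a| * N u;
  is_norm_eq0 : forall u, N u = 0 -> u = 0
}.

Definition norm_l (R : realType) (d1 d2 : nat) (N : 'rV[R]_(d1 + d2) -> R)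
  (x : 'rV[R]_d1) : R := N (row_mx x 0).

Definition norm_r (R : realType) (d1 d2 : nat) (N : 'rV[R]_(d1 + d2) -> R)
  (y : 'rV[R]_d2) : R := N (row_mx 0 y).

Definition dotp (R : realType) (n : nat) (u v : 'rV[R]_n) : R :=
  (u *m v^T) 0 0.

(* Functions on a subset [A] are total functions constrained only on [A]. *)

Definition lipschitz_wrt (R : realType) (n : nat) (N : 'rV[R]_n -> R)
    (A : set 'rV[R]_n) (G : R) (f : 'rV[R]_n -> R) : Prop :=
  forall u v, A u -> A v -> `|f u - f v| <= G * N (u - v).

Definition lipschitz2_wrt (R : realType) (d1 d2 : nat)
    (N : 'rV[R]_(d1 + d2) -> R) (X : set 'rV[R]_d1) (Y : set 'rV[R]_d2)
    (G : R) (L : 'rV[R]_d1 -> 'rV[R]_d2 -> R) : Prop :=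
  forall x1 x2 y1 y2, X x1 -> X x2 -> Y y1 -> Y y2 ->
    `|L x1 y1 - L x2 y2| <= G * N (row_mx x1 y1 - row_mx x2 y2).

Definition convex_concave (R : realType) (d1 d2 : nat)
    (X : set 'rV[R]_d1) (Y : set 'rV[R]_d2)
    (L : 'rV[R]_d1 -> 'rV[R]_d2 -> R) : Prop :=
  (forall y, Y y -> @convex_function R 'rV[R]_d1 X (fun x => L x y)) /\
  (forall x, X x -> @convex_function R 'rV[R]_d2 Y (fun y => - L x y)).

Definition subgradient (R : realType) (n : nat) (A : set 'rV[R]_n)
    (f : 'rV[R]_n -> R) (x g : 'rV[R]_n) : Prop :=
  forall z, A z -> f x + dotp g (z - x) <= f z.

Definition strongly_convex (R : realType) (n : nat) (N : 'rV[R]_n -> R)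
    (A : set 'rV[R]_n) (H : R) (f : 'rV[R]_n -> R) : Prop :=
  exists gradf : 'rV[R]_n -> 'rV[R]_n,
    (forall x, A x -> subgradient A f x (gradf x)) /\
    (forall x1 x2, A x1 -> A x2 ->
       f x2 + dotp (gradf x2) (x1 - x2) + H / 2 * N (x1 - x2) ^+ 2 <= f x1).

Definition argmin (R : realType) (T : Type) (A : set T) (f : T -> R) : set T :=
  [set x | A x /\ forall z, A z -> f x <= f z].

Definition argmax (R : realType) (T : Type) (A : set T) (f : T -> R) : set T :=
  [set x | A x /\ forall z, A z -> f z <= f x].

(* Attained extremal values; 0 by convention when the extremum is not
   attained. *)
Definition minimum (R : realType) (T : Type) (A : set T) (f : T -> R) : R :=
  xget 0 (f @` argmin A f).

Definition maximum (R : realType) (T : Type) (A : set T) (f : T -> R) : R :=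
  xget 0 (f @` argmax A f).

Definition regularized (R : realType) (d1 d2 : nat) (eta : R)
    (RX : 'rV[R]_d1 -> R) (RY : 'rV[R]_d2 -> R)
    (L : 'rV[R]_d1 -> 'rV[R]_d2 -> R) (x : 'rV[R]_d1) (y : 'rV[R]_d2) : R :=
  L x y + 1 / eta * RX x - 1 / eta * RY y.

Definition cumulative (R : realType) (d1 d2 : nat)
    (L : nat -> 'rV[R]_d1 -> 'rV[R]_d2 -> R) (t : nat)
    (x : 'rV[R]_d1) (y : 'rV[R]_d2) : R :=
  \sum_(1 <= tau < t.+1) L tau x y.

(* Rounds are numbered from 1; the values of [Lbar], [x] and [y] at 0 and after
   [T] are irrelevant. *)
Definition SP_RFTL (R : realType) (d1 d2 : nat)
    (X : set 'rV[R]_d1) (Y : set 'rV[R]_d2) (eta : R)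
    (RX : 'rV[R]_d1 -> R) (RY : 'rV[R]_d2 -> R)
    (Lbar : nat -> 'rV[R]_d1 -> 'rV[R]_d2 -> R) (T : nat)
    (x : nat -> 'rV[R]_d1) (y : nat -> 'rV[R]_d2) : Prop :=
  let F := cumulative (fun t => regularized eta RX RY (Lbar t)) in
  [/\ X (x 1), Y (y 1) &
    forall t : nat, (1 <= t < T)%N ->
      argmin X (fun u => maximum Y (fun v => F t u v)) (x t.+1) /\
      argmax Y (fun v => minimum X (fun u => F t u v)) (y t.+1)].

(* Main.v *)
(* Let [F_t] be the sum of the first [t] regularized losses [L_t] and [F_t^*] its
   value.  Its strong convexity-concavity makes the min-max and max-min iterates
   form a saddle point [(x_{t+1}, y_{t+1})] of [F_t].  Comparing consecutive
   saddle points gives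
     [L_t x_{t+1} y_t <= F_t^* - F_{t-1}^* <= L_t x_t y_{t+1}],
   so the value increment differs from [L_t x_t y_t] by at most [G] times the
   distance between the two saddle points.  Adding the quadratic growth
   inequalities of [F_{t-1}] (modulus [(t-1)/eta]) and [F_t] (modulus [t/eta])
   bounds that distance by [4 eta G / (2t-1)]; the increments telescope and the
   errors sum to a harmonic series.  Finally, removing the regularizers moves both
   the payoff and the value by at most [T/eta] times their maxima. *)
Require Import Defs.
From mathcomp Require Import all_boot all_order all_algebra.
From mathcomp Require Import all_classical all_reals all_analysis.
From mathcomp Require Import ring lra.
Import Order.TTheory GRing.Theory Num.Theory.
Import numFieldNormedType.Exports.
Local Open Scope classical_set_scope.
Local Open Scope ring_scope.

Set Implicit Arguments.
Unset Strict Implicit.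
Unset Printing Implicit Defensive.

(** Replaces letting [s] tend to 0: if [a] were positive, then so would be [b >= a], and
    [s = a / (2 * b)] would give [a <= a / 2]. *)
Lemma le0_of_le_scaled (R : realFieldType) (a b : R) :
  (forall s, 0 < s -> s <= 1 -> a <= s * b) -> a <= 0.
Proof.
move=> hab; rewrite leNgt; apply/negP => a0.
have ab : a <= b by have := hab 1 ltr01 (lexx _); rewrite mul1r.
have b0 : 0 < b by exact: lt_le_trans ab.
have s0 : 0 < a / (2 * b) by rewrite divr_gt0// mulr_gt0.
have s1 : a / (2 * b) <= 1 by rewrite ler_pdivrMr ?mulr_gt0//; lra.
have := hab _ s0 s1.
have -> : a / (2 * b) * b = a / 2 by field; rewrite gt_eqF.
lra.
Qed.

(** * Arbitrary norms and attained extrema of Lipschitz functions *)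

Section Norms.
Context (R : realType) (n : nat) (N : 'rV[R]_n -> R) (hN : is_norm N).

Lemma is_norm0 : N 0 = 0.
Proof. by rewrite -(scale0r 0) (is_normZ hN) normr0 mul0r. Qed.

Lemma is_normN u : N (- u) = N u.
Proof. by rewrite -scaleN1r (is_normZ hN) normrN1 mul1r. Qed.

Lemma is_normB u v : N (u - v) = N (v - u).
Proof. by rewrite -opprB is_normN. Qed.

Lemma is_norm_ge0 u : 0 <= N u.
Proof.
have := is_norm_triangle hN u (- u).
by rewrite subrr is_norm0 is_normN; lra.
Qed.

Lemma is_norm_sum (I : Type) (r : seq I) (f : I -> 'rV[R]_n) :
  N (\sum_(i <- r) f i) <= \sum_(i <- r) N (f i).
Proof.
elim/big_rec2: _ => [|i a u _ h]; first by rewrite is_norm0.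
exact: le_trans (is_norm_triangle hN _ _) (lerD (lexx _) h).
Qed.

(** Expansion in the standard basis compares [N] with the sup norm; this is the link between [N] and
    the topology used for compactness. *)
Lemma is_norm_le_ball (u v : 'rV[R]_n) (e : R) : ball u e v ->
  N (u - v) <= e * \sum_(i < n) N (delta_mx 0 i).
Proof.
move=> huv; rewrite [u - v]row_sum_delta mulr_sumr.
apply: le_trans (is_norm_sum _ _) _; apply: ler_sum => i _.
rewrite (is_normZ hN) ler_wpM2r ?is_norm_ge0// !mxE.
by have [_ /(_ 0 i)/ltW] := huv.
Qed.

Lemma lipschitz_wrt_continuous A G f :
  lipschitz_wrt N A G f -> {within A, continuous f}.
Proof.
move=> fL; apply/subspace_continuousP => x Ax; apply/cvgrPdist_le => e e0.
(* [G] may be negative, hence the absolute value; the [+ 1] keeps the divisor [C] positive. *)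
pose C := `|G| * (\sum_(i < n) N (delta_mx 0 i)) + 1.
have C0 : 0 < C.
  by rewrite ltr_wpDl// mulr_ge0// sumr_ge0// => i _; exact: is_norm_ge0.
have eC : 0 < e / C by exact: divr_gt0.
near=> y.
have Ay : A y by near: y; exact: withinT.
have : ball x (e / C) y by near: y; apply: cvg_within; exact: nbhsx_ballx.
move=> /is_norm_le_ball le1; apply: le_trans (fL _ _ Ax Ay) _.
apply: le_trans (ler_wpM2r (is_norm_ge0 _) (ler_norm G)) _.
apply: le_trans (ler_wpM2l (normr_ge0 G) le1) _.
by rewrite mulrCA mulrAC ler_pdivrMr// ler_wpM2l ?ltW// /C; lra.
Unshelve. all: by end_near. Qed.

Lemma lipschitz_wrt_argmax A G f : A !=set0 -> compact A ->
  lipschitz_wrt N A G f -> argmax A f !=set0.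
Proof.
move=> A0 cA /lipschitz_wrt_continuous fc.
have [c /set_mem Ac fmax] := compact_EVT_max A0 cA fc.
by exists c; split=> // z Az; apply: fmax; apply: mem_set.
Qed.

Lemma lipschitz_wrt_argmin A G f : A !=set0 -> compact A ->
  lipschitz_wrt N A G f -> argmin A f !=set0.
Proof.
move=> A0 cA /lipschitz_wrt_continuous fc.
have [c /set_mem Ac fmin] := compact_EVT_min A0 cA fc.
by exists c; split=> // z Az; apply: fmin; apply: mem_set.
Qed.
End Norms.

(** All maximisers share one value, so the choice made by [xget] is harmless and its default 0 is
    never reached. *)
Lemma maximumE (R : realType) (T : Type) (A : set T) (f : T -> R) x :
  argmax A f x -> maximum A f = f x.
Proof.
move=> [Ax fx]; rewrite /maximum.
have : (f @` argmax A f) (f x) by exists x.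
move=> /(xgetI 0) /= [z [Az fz] <-].
by apply/eqP; rewrite eq_le fx// fz.
Qed.

Lemma minimumE (R : realType) (T : Type) (A : set T) (f : T -> R) x :
  argmin A f x -> minimum A f = f x.
Proof.
move=> [Ax fx]; rewrite /minimum.
have : (f @` argmin A f) (f x) by exists x.
move=> /(xgetI 0) /= [z [Az fz] <-].
by apply/eqP; rewrite eq_le fx// fz.
Qed.

(** Each maximum is at least the value of its function at the maximiser of the other, where the
    Lipschitz bound of a single slice applies. *)
Lemma lipschitz_wrt_maximum (R : realType) (n : nat) (N : 'rV[R]_n -> R)
    (T : Type) (A : set 'rV[R]_n) (B : set T) (K : R) (F : 'rV[R]_n -> T -> R) :
  (forall u, A u -> argmax B (F u) !=set0) ->
  (forall v, B v -> lipschitz_wrt N A K (F^~ v)) ->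
  lipschitz_wrt N A K (fun u => maximum B (F u)).
Proof.
move=> hmax hlip u1 u2 Au1 Au2.
have [v1 hv1] := hmax _ Au1; have [v2 hv2] := hmax _ Au2.
rewrite (maximumE hv1) (maximumE hv2).
case: hv1 hv2 => Bv1 hv1 [Bv2 hv2].
have := hlip _ Bv1 _ _ Au1 Au2; have := hlip _ Bv2 _ _ Au1 Au2.
rewrite !ler_norml => /andP[h1 h2] /andP[h3 h4].
have := hv1 _ Bv2; have := hv2 _ Bv1; lra.
Qed.

(* Convexity with a quadratic modulus, tested on segments instead of
   subgradients: unlike [strongly_convex] it is stable under sums with merely
   convex functions ([h = 0]). *)
Definition modulus_convex (R : realType) (n : nat) (N : 'rV[R]_n -> R)
    (A : set 'rV[R]_n) (h : R) (f : 'rV[R]_n -> R) : Prop :=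
  forall a b s, A a -> A b -> 0 <= s -> s <= 1 ->
    f (s *: a + (1 - s) *: b)
    <= s * f a + (1 - s) * f b - h / 2 * (s * (1 - s)) * N (a - b) ^+ 2.

(** * Calculus of convexity moduli and quadratic growth at a minimiser *)

Section Convexity.
Context (R : realType) (n : nat) (N : 'rV[R]_n -> R).
Implicit Types (A : set 'rV[R]_n) (f g : 'rV[R]_n -> R).

Lemma convex_set_segment A a b s : @convex_set R 'rV[R]_n A ->
  A a -> A b -> 0 <= s -> s <= 1 -> A (s *: a + (1 - s) *: b).
Proof.
move=> cA Aa Ab s0 s1.
exact/set_mem/(cA a b (Itv01 s0 s1) (mem_set Aa) (mem_set Ab)).
Qed.

Lemma convex_function_modulus A f :
  @convex_function R 'rV[R]_n A f -> modulus_convex N A 0 f.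
Proof.
move=> cf a b s Aa Ab s0 s1.
rewrite !mul0r subr0.
exact: (cf (Itv01 s0 s1) a b (mem_set Aa) (mem_set Ab)).
Qed.

Lemma modulus_convex_cst A (c : R) : modulus_convex N A 0 (fun=> c).
Proof. by move=> a b s *; rewrite !mul0r subr0 -mulrDl subrKC mul1r. Qed.

Lemma modulus_convexD A h1 h2 f g :
  modulus_convex N A h1 f -> modulus_convex N A h2 g ->
  modulus_convex N A (h1 + h2) (fun u => f u + g u).
Proof.
move=> cf cg a b s Aa Ab s0 s1.
have := cf a b s Aa Ab s0 s1; have := cg a b s Aa Ab s0 s1.
lra.
Qed.

Lemma modulus_convexZ A h f c : 0 <= c ->
  modulus_convex N A h f -> modulus_convex N A (c * h) (fun u => c * f u).
Proof.
move=> c0 cf a b s Aa Ab s0 s1.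
have /(ler_wpM2l c0) := cf a b s Aa Ab s0 s1.
lra.
Qed.

(** The subgradient inequality at the intermediate point [w] is applied towards both ends. With
    weights [s] and [1 - s] the linear terms cancel, and the quadratic ones add up because
    [s (1 - s)^2 + (1 - s) s^2 = s (1 - s)]. *)
Lemma strongly_convex_modulus A h f : is_norm N ->
  @convex_set R 'rV[R]_n A -> strongly_convex N A h f -> modulus_convex N A h f.
Proof.
move=> hN cA [g [_ hg]] a b s Aa Ab s0 s1.
set w := _ + _ *: b.
have Aw : A w by exact: convex_set_segment.
have s1' : 0 <= 1 - s by rewrite subr_ge0.
have aw : a - w = (1 - s) *: (a - b).
  by rewrite /w scalerBr !scalerBl scale1r; apply/rowP => i; rewrite !mxE; ring.
have bw : b - w = (- s) *: (a - b).
  by rewrite /w scalerBr !scalerBl scale1r; apply/rowP => i; rewrite !mxE; ring.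
have := hg _ _ Aa Aw; have := hg _ _ Ab Aw.
rewrite aw bw !(is_normZ hN) normrN !ger0_norm//.
have dZ c u v : dotp u (c *: v) = c * dotp u v.
  by rewrite /dotp linearZ/= -scalemxAr mxE.
rewrite !dZ => /(ler_wpM2l s1') hb /(ler_wpM2l s0) ha.
lra.
Qed.

(** Minimality of [x] against [s u + (1 - s) x], divided by [s], leaves an error proportional to
    [s], which then tends to 0. *)
Lemma modulus_convex_growth A h f x u : is_norm N ->
  @convex_set R 'rV[R]_n A -> modulus_convex N A h f -> argmin A f x -> A u ->
  f x + h / 2 * N (u - x) ^+ 2 <= f u.
Proof.
move=> hN cA cf [Ax fx] Au; rewrite -subr_le0.
apply: (@le0_of_le_scaled _ _ (h / 2 * N (u - x) ^+ 2)) => s s0 s1.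
have Aw := convex_set_segment cA Au Ax (ltW s0) s1.
have := le_trans (fx _ Aw) (cf _ _ _ Au Ax (ltW s0) s1).
set q := N _ ^+ 2 => h1.
rewrite -(ler_pM2l s0); lra.
Qed.
End Convexity.

(** * Saddle points: existence, and their relation to min-max strategies *)

Definition saddle_point (R : realType) (U V : Type) (X : set U) (Y : set V)
    (F : U -> V -> R) (x : U) (y : V) : Prop :=
  argmin X (F^~ y) x /\ argmax Y (F x) y.

(* Minimise [u |-> max_v F u v] at [x], and let [y_s] be the best response to
   [s u + (1 - s) x].  Optimality of [x] gives [F x y <= F u y_s], and strong
   concavity forces [y_s --> y] as [s --> 0]. *)
Lemma saddle_point_exists (R : realType) (n1 n2 : nat)
    (N1 : 'rV[R]_n1 -> R) (N2 : 'rV[R]_n2 -> R)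
    (X : set 'rV[R]_n1) (Y : set 'rV[R]_n2)
    (F : 'rV[R]_n1 -> 'rV[R]_n2 -> R) (K h : R) :
  is_norm N1 -> is_norm N2 ->
  X !=set0 -> @convex_set R 'rV[R]_n1 X -> compact X ->
  Y !=set0 -> @convex_set R 'rV[R]_n2 Y -> compact Y ->
  (forall v, Y v -> lipschitz_wrt N1 X K (F^~ v)) ->
  (forall u, X u -> lipschitz_wrt N2 Y K (F u)) ->
  (forall v, Y v -> modulus_convex N1 X 0 (F^~ v)) ->
  (forall u, X u -> modulus_convex N2 Y h (fun v => - F u v)) ->
  0 < h ->
  exists x y, saddle_point X Y F x y.
Proof.
move=> hN1 hN2 X0 cX kX Y0 cY kY lipX lipY cvx ccv h0.
have amax u : X u -> argmax Y (F u) !=set0.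
  by move=> Xu; exact: (lipschitz_wrt_argmax hN2 Y0 kY (lipY _ Xu)).
have [x [Xx xmin]] : argmin X (fun u => maximum Y (F u)) !=set0.
  exact: (lipschitz_wrt_argmin hN1 X0 kX (lipschitz_wrt_maximum amax lipX)).
have [y xy] := amax _ Xx; have [Yy ymax] := xy.
exists x, y; split=> //; split=> // u Xu; rewrite -subr_le0.
have [//|d0] := leP (F x y - F u y) 0.
(* Quadratic growth controls only the square of [N2 (ys - y)] by a multiple of [s]; squaring the gap
   makes its bound linear in [s]. *)
suff : (F x y - F u y) ^+ 2 <= 0 by rewrite leNgt exprn_gt0.
apply: (@le0_of_le_scaled _ _ (4 * K ^+ 2 * K * N1 (u - x) / h)) => s s0 s1.
set w := s *: u + (1 - s) *: x.
have Xw : X w by exact: convex_set_segment cX Xu Xx (ltW s0) s1.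
have [ys wys] := amax _ Xw; have [Yys ysmax] := wys.
have hxw : F x y <= F w ys.
  by rewrite -(maximumE xy) -(maximumE wys); exact: xmin.
have hu : F x y <= F u ys.
  rewrite -(ler_pM2l s0).
  have := cvx _ Yys _ _ _ Xu Xx (ltW s0) s1; rewrite -/w => hw.
  have s1' : 0 <= 1 - s by rewrite subr_ge0.
  have := ler_wpM2l s1' (ymax _ Yys); lra.
have grow : h / 2 * N2 (ys - y) ^+ 2 <= F x y - F x ys.
  have ymin : argmin Y (fun v => - F x v) y.
    by split=> // v Yv; rewrite lerN2 ymax.
  have := modulus_convex_growth hN2 cY (ccv _ Xx) ymin Yys; lra.
have wx : N1 (w - x) = s * N1 (u - x).
  have -> : w - x = s *: (u - x).
    by rewrite /w scalerBr scalerBl scale1r; apply/rowP => i; rewrite !mxE; ring.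
  by rewrite (is_normZ hN1) gtr0_norm.
have := lipX _ Yys _ _ Xw Xx; have := lipX _ Yy _ _ Xw Xx.
rewrite wx !ler_norml => /andP[l1 _] /andP[_ l2].
(* Since [F w y <= F w ys], the loss [F x y - F x ys] comes only from moving between [x] and [w]
   twice, at cost [K * s * N1 (u - x)] each time. *)
have hd : h / 2 * N2 (ys - y) ^+ 2 <= 2 * K * s * N1 (u - x).
  have := ysmax _ Yy; lra.
have := lipY _ Xu _ _ Yys Yy; rewrite ler_norml => /andP[_ l3].
have l4 : F x y - F u y <= K * N2 (ys - y) by lra.
have := lerXn2r 2 (ltW d0) (le_trans (ltW d0) l4) l4.
rewrite exprMn => /le_trans; apply.
rewrite [leRHS]mulrA ler_pdivlMr//.
have := ler_wpM2l (sqr_ge0 K) hd; lra.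
Qed.

(** Any saddle point [(u, v)] fixes the value of the game. The min-max [x] never pays more than
    [F u v] and the max-min [y] never gets less, so [F x y] equals that value and each is a best
    response to the other. *)
Lemma saddle_point_argminmax (R : realType) (U V : Type) (X : set U) (Y : set V)
    (F : U -> V -> R) x y :
  (forall u, X u -> argmax Y (F u) !=set0) ->
  (forall v, Y v -> argmin X (F^~ v) !=set0) ->
  (exists u v, saddle_point X Y F u v) ->
  argmin X (fun u => maximum Y (F u)) x ->
  argmax Y (fun v => minimum X (F^~ v)) y ->
  saddle_point X Y F x y.
Proof.
move=> amax amin [u [v [uv vu]]] [Xx xmin] [Yy ymax].
have [Xu umin] := uv; have [Yv vmax] := vu.
have hx w : Y w -> F x w <= F u v.
  move=> Yw; rewrite -(maximumE vu); apply: le_trans (xmin _ Xu).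
  by have [z xz] := amax _ Xx; rewrite (maximumE xz); exact: xz.2.
have hy w : X w -> F u v <= F w y.
  move=> Xw; rewrite -(minimumE uv); apply: le_trans (ymax _ Yv) _.
  by have [z zy] := amin _ Yy; rewrite (minimumE zy); exact: zy.2.
by split; split=> // w ?; [have := hx _ Yy | have := hy _ Xx] => le1;
  [apply: le_trans le1 (hy _ _) | apply: le_trans (hx _ _) le1].
Qed.

(** * Movement of the saddle point and of the value when one loss is added *)

Section Stability.
Context (R : realType) (n1 n2 : nat) (N1 : 'rV[R]_n1 -> R) (N2 : 'rV[R]_n2 -> R).
Context (X : set 'rV[R]_n1) (Y : set 'rV[R]_n2).
Context (hN1 : is_norm N1) (hN2 : is_norm N2).
Context (cX : @convex_set R 'rV[R]_n1 X) (cY : @convex_set R 'rV[R]_n2 Y).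

Lemma saddle_point_growth (F : 'rV[R]_n1 -> 'rV[R]_n2 -> R) (h : R) x y u v :
  (forall v, Y v -> modulus_convex N1 X h (F^~ v)) ->
  (forall u, X u -> modulus_convex N2 Y h (fun v => - F u v)) ->
  saddle_point X Y F x y -> X u -> Y v ->
  h / 2 * (N1 (u - x) ^+ 2 + N2 (v - y) ^+ 2) <= F u y - F x v.
Proof.
move=> cvx ccv [xmin ymax] Xu Yv.
have := modulus_convex_growth hN1 cX (cvx _ ymax.1) xmin Xu.
have ymin : argmin Y (fun v => - F x v) y.
  by split=> [|w Yw]; [exact: ymax.1 | rewrite lerN2; exact: ymax.2].
have := modulus_convex_growth hN2 cY (ccv _ xmin.1) ymin Yv; lra.
Qed.

Context (F L F' : 'rV[R]_n1 -> 'rV[R]_n2 -> R) (a b G : R).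
Context (FL : forall u v, F' u v = F u v + L u v).
Context (cvxF : forall v, Y v -> modulus_convex N1 X a (F^~ v)).
Context (ccvF : forall u, X u -> modulus_convex N2 Y a (fun v => - F u v)).
Context (cvxF' : forall v, Y v -> modulus_convex N1 X b (F'^~ v)).
Context (ccvF' : forall u, X u -> modulus_convex N2 Y b (fun v => - F' u v)).
Context (lipX : forall v, Y v -> lipschitz_wrt N1 X G (L^~ v)).
Context (lipY : forall u, X u -> lipschitz_wrt N2 Y G (L u)).
Context (x x' : 'rV[R]_n1) (y y' : 'rV[R]_n2).
Context (sF : saddle_point X Y F x y) (sF' : saddle_point X Y F' x' y').

(** Add the growth of [F] at [(x', y')] to that of [F'] at [(x, y)]: the terms in [F] cancel,
    leaving [L x y' - L x' y], which is compared with [L x y] through one coordinate at a time. *)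
Lemma saddle_point_stability :
  (a + b) / 2 * (N1 (x' - x) ^+ 2 + N2 (y' - y) ^+ 2)
  <= G * (N1 (x' - x) + N2 (y' - y)).
Proof.
have [[Xx _] [Yy _]] := sF; have [[Xx' _] [Yy' _]] := sF'.
have := saddle_point_growth cvxF ccvF sF Xx' Yy'.
have := saddle_point_growth cvxF' ccvF' sF' Xx Yy.
rewrite (is_normB hN1 x) (is_normB hN2 y) !FL.
have := lipX Yy Xx' Xx; have := lipY Xx Yy' Yy.
rewrite !ler_norml => /andP[_ l1] /andP[l2 _]; lra.
Qed.

(** The increment lies between [L x' y] and [L x y'], each within [G] times one displacement of
    [L x y]. Stability and [(p + q)^2 <= 2 (p^2 + q^2)] bound the total displacement [p + q] by
    [4 G / (a + b)]. *)
Lemma saddle_value_increment : 0 < a + b ->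
  `|L x y - (F' x' y' - F x y)| <= 4 * G ^+ 2 / (a + b).
Proof.
move=> ab0.
have [[Xx xmin] [Yy ymax]] := sF; have [[Xx' xmin'] [Yy' ymax']] := sF'.
have stab := saddle_point_stability.
have := is_norm_ge0 hN1 (x' - x); have := is_norm_ge0 hN2 (y' - y).
have := xmin' _ Xx; have := ymax' _ Yy; have := xmin _ Xx'; have := ymax _ Yy'.
have := lipX Yy Xx' Xx; have := lipY Xx Yy' Yy.
rewrite !FL !ler_norml.
move: stab; set p := N1 _; set q := N2 _.
move=> stab /andP[_ l1] /andP[l2 _] h1 h2 h3 h4 q0 p0.
have pq : (p + q) ^+ 2 <= 2 * (p ^+ 2 + q ^+ 2).
  by have := sqr_ge0 (p - q); lra.
have stab' : (a + b) * (p + q) ^+ 2 <= 4 * G * (p + q).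
  by have := ler_wpM2l (ltW ab0) pq; lra.
have Gpq : 0 <= G * (p + q).
  by have := mulr_ge0 (ltW ab0) (sqr_ge0 (p + q)); lra.
have bound : G * (p + q) <= 4 * G ^+ 2 / (a + b).
  rewrite ler_pdivlMr//.
  have [pq0|pq0] := eqVneq (p + q) 0.
    by rewrite pq0 mulr0 mul0r mulr_ge0// sqr_ge0.
  have pq1 : 0 < p + q by rewrite lt_neqAle eq_sym pq0 addr_ge0.
  have G0 : 0 <= G by rewrite -(pmulr_lge0 _ pq1).
  have : (a + b) * (p + q) <= 4 * G by rewrite -(ler_pM2r pq1) -mulrA -expr2.
  by move=> /(ler_wpM2l G0); lra.
(* A negative [G] is consistent with [0 <= G * (p + q)] only when both displacements vanish. *)
have [G0|G0] := leP 0 G.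
  by apply/andP; have := mulr_ge0 G0 p0; have := mulr_ge0 G0 q0; lra.
have pq0 : p + q <= 0 by rewrite -(nmulr_rge0 _ G0).
have [pE qE] : p = 0 /\ q = 0 by split; lra.
by move: l1 l2 bound; rewrite pE qE; lra.
Qed.
End Stability.

(** * Harmonic sums and sums of losses *)

(** Induction: [1 / (m + 1) <= ln (m + 1) - ln m] is [ln (1 + z) <= z] at [z = - 1 / (m + 1)]. *)
Lemma harmonic_le_ln (R : realType) (n : nat) : (0 < n)%N ->
  \sum_(1 <= t < n.+1) t%:R^-1 <= 1 + ln n%:R :> R.
Proof.
case: n => // n _; elim: n => [|n IH].
  by rewrite big_nat1 ln1 invr1 addr0.
rewrite big_nat_recr//=; apply: le_trans (lerD IH (lexx _)) _.
set m : R := n.+1%:R.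
have m0 : 0 < m by rewrite ltr0n.
have mS : n.+2%:R = m + 1 :> R by rewrite [LHS]mulrSr.
rewrite mS -addrA lerD2l -lerBrDl -[leLHS]opprK lerNl opprB.
have m10 : 0 < m + 1 by lra.
have -> : ln m - ln (m + 1) = ln (1 + - (m + 1)^-1).
  rewrite -ln_div ?posrE//; congr ln; field; lra.
apply: le_ln1Dx; rewrite ltrN2 invf_lt1//; lra.
Qed.

Lemma cumulativeS (R : realType) (d1 d2 : nat)
    (L : nat -> 'rV[R]_d1 -> 'rV[R]_d2 -> R) t u v :
  Defs.cumulative L t.+1 u v = Defs.cumulative L t u v + L t.+1 u v.
Proof. by rewrite /Defs.cumulative big_nat_recr. Qed.

Lemma modulus_convex_sum (R : realType) (n : nat) (N : 'rV[R]_n -> R)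
    (A : set 'rV[R]_n) (h : R) (f : nat -> 'rV[R]_n -> R) (t : nat) :
  (forall i, (1 <= i <= t)%N -> modulus_convex N A h (f i)) ->
  modulus_convex N A (t%:R * h) (fun u => \sum_(1 <= i < t.+1) f i u).
Proof.
elim: t => [|t IH] cf.
  rewrite mul0r; under eq_fun do rewrite big_geq//; exact: modulus_convex_cst.
under eq_fun do rewrite big_nat_recr//=.
rewrite -[t.+1%:R]natr1 mulrDl mul1r; apply: modulus_convexD.
  by apply: IH => i /andP[i1 it]; apply: cf; rewrite i1 leqW.
by apply: cf; rewrite leqnn.
Qed.

Lemma lipschitz_wrt_sum (R : realType) (n : nat) (N : 'rV[R]_n -> R)
    (A : set 'rV[R]_n) (G : R) (f : nat -> 'rV[R]_n -> R) (t : nat) :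
  (forall i, (1 <= i <= t)%N -> lipschitz_wrt N A G (f i)) ->
  lipschitz_wrt N A (t%:R * G) (fun u => \sum_(1 <= i < t.+1) f i u).
Proof.
move=> fL u v Au Av; rewrite -sumrB.
apply: le_trans (ler_norm_sum _ _ _) _.
have -> : t%:R * G * N (u - v) = \sum_(1 <= i < t.+1) G * N (u - v).
  by rewrite sumr_const_nat subn1/= -mulrA mulr_natl.
by apply: ler_sum_nat => i it; exact: fL.
Qed.

Lemma lipschitz_wrt_combine (R : realType) (n : nat) (N : 'rV[R]_n -> R)
    (A : set 'rV[R]_n) (f g F : 'rV[R]_n -> R) (Kf Kg K c : R) :
  is_norm N -> 0 <= c -> lipschitz_wrt N A Kf f -> lipschitz_wrt N A Kg g ->
  Kg <= K ->
  (forall u v, `|F u - F v| <= `|f u - f v| + c * `|g u - g v|) ->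
  lipschitz_wrt N A (Kf + c * K) F.
Proof.
move=> hN c0 hf hg KgK hF u v Au Av; apply: le_trans (hF u v) _.
rewrite mulrDl -mulrA lerD ?hf// ler_wpM2l//.
exact: le_trans (hg _ _ Au Av) (ler_wpM2r (is_norm_ge0 hN _) KgK).
Qed.

(** * Regret of the leader and properties of the regularized losses *)

Section Game.
Context (R : realType) (d1 d2 : nat) (N : 'rV[R]_(d1 + d2) -> R).
Context (hN : is_norm N).

Lemma is_norm_l : is_norm (norm_l N).
Proof.
split=> [u v|a u|u].
- by have := is_norm_triangle hN (row_mx u 0) (row_mx v 0); rewrite add_row_mx addr0.
- by have := is_normZ hN a (row_mx u 0); rewrite scale_row_mx scaler0.
- by move/(is_norm_eq0 hN)/eqP; rewrite row_mx_eq0 => /andP[/eqP].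
Qed.

Lemma is_norm_r : is_norm (norm_r N).
Proof.
split=> [u v|a u|u].
- by have := is_norm_triangle hN (row_mx 0 u) (row_mx 0 v); rewrite add_row_mx addr0.
- by have := is_normZ hN a (row_mx 0 u); rewrite scale_row_mx scaler0.
- by move/(is_norm_eq0 hN)/eqP; rewrite row_mx_eq0 => /andP[_ /eqP].
Qed.

Context (X : set 'rV[R]_d1) (Y : set 'rV[R]_d2).

Lemma lipschitz2_wrt_l G (L : 'rV[R]_d1 -> 'rV[R]_d2 -> R) v : Y v ->
  lipschitz2_wrt N X Y G L -> lipschitz_wrt (norm_l N) X G (L^~ v).
Proof.
move=> Yv hL u1 u2 Xu1 Xu2; have := hL _ _ _ _ Xu1 Xu2 Yv Yv.
by rewrite opp_row_mx add_row_mx subrr.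
Qed.

Lemma lipschitz2_wrt_r G (L : 'rV[R]_d1 -> 'rV[R]_d2 -> R) u : X u ->
  lipschitz2_wrt N X Y G L -> lipschitz_wrt (norm_r N) Y G (L u).
Proof.
move=> Xu hL v1 v2 Yv1 Yv2; have := hL _ _ _ _ Xu Xu Yv1 Yv2.
by rewrite opp_row_mx add_row_mx subrr.
Qed.

Context (cX : @convex_set R 'rV[R]_d1 X) (cY : @convex_set R 'rV[R]_d2 Y).
Context (X0 : X !=set0) (kX : compact X) (Y0 : Y !=set0) (kY : compact Y).

(* [(x t, y t)] is optimal for the first [t - 1] losses, for [t] up to [T + 1]:
   one round more than the algorithm plays. *)
Lemma leader_regret (L : nat -> 'rV[R]_d1 -> 'rV[R]_d2 -> R) (T : nat)
    (h G : R) (x : nat -> 'rV[R]_d1) (y : nat -> 'rV[R]_d2) :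
  0 < h -> (1 <= T)%N ->
  (forall t v, (1 <= t <= T)%N -> Y v -> modulus_convex (norm_l N) X h (L t ^~ v)) ->
  (forall t u, (1 <= t <= T)%N -> X u ->
    modulus_convex (norm_r N) Y h (fun v => - L t u v)) ->
  (forall t v, (1 <= t <= T)%N -> Y v -> lipschitz_wrt (norm_l N) X G (L t ^~ v)) ->
  (forall t u, (1 <= t <= T)%N -> X u -> lipschitz_wrt (norm_r N) Y G (L t u)) ->
  (forall t, (t <= T)%N -> saddle_point X Y (Defs.cumulative L t) (x t.+1) (y t.+1)) ->
  `|\sum_(1 <= t < T.+1) L t (x t) (y t) - Defs.cumulative L T (x T.+1) (y T.+1)|
  <= 4 * G ^+ 2 / h * (1 + ln T%:R).
Proof.
move=> h0 T1 cvx ccv lipX lipY sad.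
(* [V t] is the value of the game after [t] rounds; [V 0] is an empty sum, so the increments
   telescope to [V T]. *)
pose V t := Defs.cumulative L t (x t.+1) (y t.+1).
have -> : Defs.cumulative L T (x T.+1) (y T.+1) = \sum_(1 <= t < T.+1) (V t - V t.-1).
  by rewrite big_add1 (telescope_sumr V)// /V [X in _ - X]big_geq// subr0.
rewrite -sumrB; apply: le_trans (ler_norm_sum _ _ _) _.
have c0 : 0 <= 4 * G ^+ 2 / h := divr_ge0 (mulr_ge0 (ler0n _ 4) (sqr_ge0 G)) (ltW h0).
apply: le_trans (ler_wpM2l c0 (harmonic_le_ln R T1)).
(* From here on the round is [t.+1], and [t] counts the losses before it. *)
rewrite mulr_sumr; apply: ler_sum_nat => -[//|t] /= tT1.
have tT : (t < T)%N := tT1.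
have cumX s v : (s <= T)%N -> Y v ->
    modulus_convex (norm_l N) X (s%:R * h) (Defs.cumulative L s ^~ v).
  move=> sT Yv; apply: modulus_convex_sum => i /andP[i1 si].
  by apply: cvx => //; rewrite i1 (leq_trans si).
have cumY s u : (s <= T)%N -> X u ->
    modulus_convex (norm_r N) Y (s%:R * h) (fun v => - Defs.cumulative L s u v).
  move=> sT Xu; rewrite /Defs.cumulative; under eq_fun do rewrite -sumrN.
  apply: modulus_convex_sum => i /andP[i1 si].
  by apply: ccv => //; rewrite i1 (leq_trans si).
have tT' : (t <= T)%N by exact: ltnW.
have ab : 0 < t%:R * h + t.+1%:R * h.
  by rewrite -mulrDl -natrD mulr_gt0// ltr0n addnS.
have incr := saddle_value_increment is_norm_l is_norm_r cX cY (cumulativeS L t)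
  (fun v => cumX t v tT') (fun u => cumY t u tT')
  (fun v => cumX t.+1 v tT) (fun u => cumY t.+1 u tT)
  (fun v => lipX t.+1 v tT1) (fun u => lipY t.+1 u tT1)
  (sad _ tT') (sad _ tT) ab.
apply: le_trans incr _.
(* The two moduli add up to [(2 t + 1) h], which is at least [(t + 1) h]; this yields the harmonic
   term. *)
rewrite -[leRHS]mulrA -invfM.
apply: (ler_wpM2l (mulr_ge0 (ler0n _ 4) (sqr_ge0 G))).
have t0 : 0 < h * t.+1%:R by rewrite mulr_gt0// ltr0n.
rewrite lef_pV2 ?posrE// [h * _]mulrC lerDr.
exact: mulr_ge0 (ler0n _ _) (ltW h0).
Qed.

(** The second conclusion makes the iterates saddle points; the first provides the pair after round
    [T], which the algorithm does not compute. *)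
Lemma cumulative_saddle_point (L : nat -> 'rV[R]_d1 -> 'rV[R]_d2 -> R) (t : nat)
    (h G : R) :
  0 < h -> (1 <= t)%N ->
  (forall i v, (1 <= i <= t)%N -> Y v -> modulus_convex (norm_l N) X h (L i ^~ v)) ->
  (forall i u, (1 <= i <= t)%N -> X u ->
    modulus_convex (norm_r N) Y h (fun v => - L i u v)) ->
  (forall i v, (1 <= i <= t)%N -> Y v -> lipschitz_wrt (norm_l N) X G (L i ^~ v)) ->
  (forall i u, (1 <= i <= t)%N -> X u -> lipschitz_wrt (norm_r N) Y G (L i u)) ->
  let F := Defs.cumulative L t in
  (exists u v, saddle_point X Y F u v) /\
  forall u v, argmin X (fun u => maximum Y (F u)) u ->
    argmax Y (fun v => minimum X (F^~ v)) v -> saddle_point X Y F u v.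
Proof.
move=> h0 t1 cvx ccv lipX lipY F.
have FlipX v : Y v -> lipschitz_wrt (norm_l N) X (t%:R * G) (F^~ v).
  by move=> Yv; apply: lipschitz_wrt_sum => i it; exact: lipX.
have FlipY u : X u -> lipschitz_wrt (norm_r N) Y (t%:R * G) (F u).
  by move=> Xu; apply: lipschitz_wrt_sum => i it; exact: lipY.
have Fsad : exists u v, saddle_point X Y F u v.
  apply: (saddle_point_exists is_norm_l is_norm_r X0 cX kX Y0 cY kY FlipX FlipY
    (h := t%:R * h)).
  (* Existence asks for plain convexity in the first variable, so the quadratic term is dropped. *)
  - move=> v Yv; rewrite -(mulr0 t%:R); apply: modulus_convex_sum => i it.
    move=> a b s Xa Xb s0 s1; apply: le_trans (cvx i v it Yv a b s Xa Xb s0 s1) _.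
    have : 0 <= h * (s * (1 - s)) * norm_l N (a - b) ^+ 2.
      rewrite mulr_ge0 ?sqr_ge0// mulr_ge0 ?(ltW h0)// mulr_ge0// subr_ge0//.
    lra.
  - move=> u Xu; rewrite /F /Defs.cumulative; under eq_fun do rewrite -sumrN.
    by apply: modulus_convex_sum => i it; exact: ccv.
  - by rewrite mulr_gt0// ltr0n.
split=> // u v; apply: saddle_point_argminmax => // w hw.
- exact: (lipschitz_wrt_argmax is_norm_r Y0 kY (FlipY _ hw)).
- exact: (lipschitz_wrt_argmin is_norm_l X0 kX (FlipX _ hw)).
Qed.

Context (eta : R) (eta0 : 0 < eta).
Context (RX : 'rV[R]_d1 -> R) (RY : 'rV[R]_d2 -> R) (GL GRX GRY : R).
Context (Lbar : 'rV[R]_d1 -> 'rV[R]_d2 -> R).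
Let G := GL + 1 / eta * Num.max GRX GRY.
Let L := regularized eta RX RY Lbar.
Let eta1 : 0 < 1 / eta := divr_gt0 ltr01 eta0.

(** For fixed [v] the term in [RY] is a constant, so the modulus comes from [RX / eta] alone. *)
Lemma regularized_modulus_l v : Y v -> convex_concave X Y Lbar ->
  strongly_convex (norm_l N) X 1 RX ->
  modulus_convex (norm_l N) X (1 / eta) (L^~ v).
Proof.
move=> Yv [cvx _] /(strongly_convex_modulus is_norm_l cX) sX.
have := modulus_convexD (modulus_convexD
  (convex_function_modulus (norm_l N) (cvx _ Yv))
  (modulus_convexZ (ltW eta1) sX))
  (modulus_convex_cst (norm_l N) (A := X) (- (1 / eta * RY v))).
by rewrite add0r addr0 mulr1.
Qed.

Lemma regularized_modulus_r u : X u -> convex_concave X Y Lbar ->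
  strongly_convex (norm_r N) Y 1 RY ->
  modulus_convex (norm_r N) Y (1 / eta) (fun v => - L u v).
Proof.
move=> Xu [_ ccv] /(strongly_convex_modulus is_norm_r cY) sY.
have -> : (fun v => - L u v) = (fun v => - Lbar u v + - (1 / eta * RX u) + 1 / eta * RY v).
  by apply/funext => v; rewrite /L /regularized; lra.
have := modulus_convexD (modulus_convexD
  (convex_function_modulus (norm_r N) (ccv _ Xu))
  (modulus_convex_cst (norm_r N) (A := Y) (- (1 / eta * RX u))))
  (modulus_convexZ (ltW eta1) sY).
by rewrite !add0r mulr1.
Qed.

Lemma regularized_lipschitz_l v : Y v -> lipschitz2_wrt N X Y GL Lbar ->
  lipschitz_wrt (norm_l N) X GRX RX -> lipschitz_wrt (norm_l N) X G (L^~ v).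
Proof.
move=> Yv hL hR.
apply: (lipschitz_wrt_combine is_norm_l (c := 1 / eta) (ltW eta1)
  (lipschitz2_wrt_l Yv hL) hR) => [|u1 u2].
  by rewrite le_max lexx.
rewrite -[1 / eta in leRHS](gtr0_norm eta1) -normrM.
by apply: le_trans (ler_normD _ _); rewrite /L /regularized le_eqVlt; apply/orP;
  left; apply/eqP; congr `|_|; ring.
Qed.

Lemma regularized_lipschitz_r u : X u -> lipschitz2_wrt N X Y GL Lbar ->
  lipschitz_wrt (norm_r N) Y GRY RY -> lipschitz_wrt (norm_r N) Y G (L u).
Proof.
move=> Xu hL hR.
apply: (lipschitz_wrt_combine is_norm_r (c := 1 / eta) (ltW eta1)
  (lipschitz2_wrt_r Xu hL) hR) => [|u1 u2].
  by rewrite le_max lexx orbT.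
rewrite -[1 / eta in leRHS](gtr0_norm eta1) -normrM.
by apply: le_trans (ler_normB _ _); rewrite /L /regularized le_eqVlt; apply/orP;
  left; apply/eqP; congr `|_|; ring.
Qed.
End Game.

(** * Removal of the regularizers and conclusion *)

Lemma cumulative_regularized (R : realType) (d1 d2 : nat) (eta : R)
    (RX : 'rV[R]_d1 -> R) (RY : 'rV[R]_d2 -> R)
    (Lbar : nat -> 'rV[R]_d1 -> 'rV[R]_d2 -> R) (t : nat) u v :
  Defs.cumulative (fun i => regularized eta RX RY (Lbar i)) t u v
  = \sum_(1 <= i < t.+1) Lbar i u v + t%:R / eta * RX u - t%:R / eta * RY v.
Proof.
rewrite /Defs.cumulative /regularized sumrB big_split/= !sumr_const_nat subn1/=.
by rewrite -(mulr_natl (1 / eta * RX u)) -(mulr_natl (1 / eta * RY v)); ring.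
Qed.

Lemma sum_scaled_bounds (R : realType) (f : nat -> R) (M eta : R) (T : nat) :
  0 < eta -> (forall t, (1 <= t <= T)%N -> 0 <= f t <= M) ->
  0 <= \sum_(1 <= t < T.+1) 1 / eta * f t <= T%:R / eta * M.
Proof.
move=> eta0 hf; have eta1 : 0 <= 1 / eta by exact/ltW/divr_gt0.
have -> : T%:R / eta * M = \sum_(1 <= t < T.+1) 1 / eta * M.
  by rewrite sumr_const_nat subn1/= -(mulr_natl (1 / eta * M)); ring.
apply/andP; split.
  rewrite big_nat_cond sumr_ge0// => t /andP[/hf/andP[f0 _] _].
  exact: mulr_ge0.
by apply: ler_sum_nat => t /hf/andP[_ fM]; rewrite ler_wpM2l.
Qed.

Unset Implicit Arguments.

Theorem theorem2 (R : realType) (d1 d2 : nat) (N : 'rV[R]_(d1 + d2) -> R)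
  (X : set 'rV[R]_d1) (Y : set 'rV[R]_d2) (T : nat)
  (Lbar : nat -> 'rV[R]_d1 -> 'rV[R]_d2 -> R)
  (RX : 'rV[R]_d1 -> R) (RY : 'rV[R]_d2 -> R)
  (GL GRX GRY eta : R) (x : nat -> 'rV[R]_d1) (y : nat -> 'rV[R]_d2)
  (hN : is_norm N)
  (hX0 : X !=set0) (hXconv : @convex_set R 'rV[R]_d1 X) (hXcomp : compact X)
  (hY0 : Y !=set0) (hYconv : @convex_set R 'rV[R]_d2 Y) (hYcomp : compact Y)
  (hT : (1 <= T)%N)
  (hLcc : forall t : nat, (1 <= t <= T)%N -> convex_concave X Y (Lbar t))
  (hLlip : forall t : nat, (1 <= t <= T)%N -> lipschitz2_wrt N X Y GL (Lbar t))
  (hRX0 : forall u, X u -> 0 <= RX u)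
  (hRY0 : forall v, Y v -> 0 <= RY v)
  (hRXsc : strongly_convex (norm_l N) X 1 RX)
  (hRYsc : strongly_convex (norm_r N) Y 1 RY)
  (hRXlip : lipschitz_wrt (norm_l N) X GRX RX)
  (hRYlip : lipschitz_wrt (norm_r N) Y GRY RY)
  (heta : 0 < eta)
  (hxy : SP_RFTL X Y eta RX RY Lbar T x y) :
  `|\sum_(1 <= t < T.+1) Lbar t (x t) (y t)
    - minimum X (fun u => maximum Y (fun v => \sum_(1 <= t < T.+1) Lbar t u v))|
  <= 8 * eta * (GL + 1 / eta * Num.max GRX GRY) ^+ 2 * (1 + ln (T%:R))
     + T%:R / eta * maximum Y RY + T%:R / eta * maximum X RX.
Proof.
have hNl := is_norm_l hN; have hNr := is_norm_r hN.
pose L t := regularized eta RX RY (Lbar t).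
pose G := GL + 1 / eta * Num.max GRX GRY.
have eta1 : 0 < 1 / eta by exact: divr_gt0.
have cvx t v : (1 <= t <= T)%N -> Y v ->
    modulus_convex (norm_l N) X (1 / eta) (L t ^~ v).
  by move=> tT Yv; apply: (regularized_modulus_l hN hXconv (Y := Y)) => //; exact: hLcc.
have ccv t u : (1 <= t <= T)%N -> X u ->
    modulus_convex (norm_r N) Y (1 / eta) (fun v => - L t u v).
  by move=> tT Xu; apply: (regularized_modulus_r hN (X := X)) => //; exact: hLcc.
have lipX t v : (1 <= t <= T)%N -> Y v -> lipschitz_wrt (norm_l N) X G (L t ^~ v).
  by move=> tT Yv; apply: (regularized_lipschitz_l hN (Y := Y)) => //; exact: hLlip.
have lipY t u : (1 <= t <= T)%N -> X u -> lipschitz_wrt (norm_r N) Y G (L t u).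
  by move=> tT Xu; apply: (regularized_lipschitz_r hN (X := X)) => //; exact: hLlip.
have sad t : (1 <= t <= T)%N ->
    (exists u v, saddle_point X Y (Defs.cumulative L t) u v) /\
    forall u v, argmin X (fun u => maximum Y (Defs.cumulative L t u)) u ->
      argmax Y (fun v => minimum X (Defs.cumulative L t ^~ v)) v ->
      saddle_point X Y (Defs.cumulative L t) u v.
  case/andP=> t1 tT.
  have sub i : (1 <= i <= t)%N -> (1 <= i <= T)%N.
    by case/andP=> -> it; exact: leq_trans it tT.
  apply: (cumulative_saddle_point hN hXconv hYconv hX0 hXcomp hY0 hYcomp eta1 t1
    (G := G)) => i w /sub iT.
  - exact: cvx.
  - exact: ccv.
  - exact: lipX.
  - exact: lipY.
have [[xs [ys sT]] _] := sad T (introT andP (conj hT (leqnn T))).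
(* A saddle point of all [T] losses is appended to the iterates. *)
pose x' t := if (t <= T)%N then x t else xs.
pose y' t := if (t <= T)%N then y t else ys.
case: hxy => Xx1 Yy1 hxy.
have sad' t : (t <= T)%N ->
    saddle_point X Y (Defs.cumulative L t) (x' t.+1) (y' t.+1).
  rewrite /x' /y' leq_eqVlt => /predU1P[->|tT]; first by rewrite ltnn.
  (* At [t = 0] the cumulative loss is identically 0, so the arbitrary feasible starting pair is a
     saddle point. *)
  rewrite tT; case: t tT => [|t] tT.
    have L0 u v : Defs.cumulative L 0 u v = 0 by rewrite /Defs.cumulative big_geq.
    by split; split=> // w _; rewrite !L0.
  have tT' : (1 <= t.+1 < T)%N by [].
  have [hx hy] := hxy _ tT'.
  exact: (sad t.+1 (ltnW tT)).2 hx hy.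
have Xx t : (1 <= t <= T)%N -> X (x t).
  case: t => // t tT; have [[+ _] _] := sad' t (ltnW tT).
  by rewrite /x' ifT.
have Yy t : (1 <= t <= T)%N -> Y (y t).
  case: t => // t tT; have [_ [+ _]] := sad' t (ltnW tT).
  by rewrite /y' ifT.
have regret := leader_regret hN hXconv hYconv eta1 hT cvx ccv lipX lipY sad'.
have xT : x' T.+1 = xs by rewrite /x' ltnn.
have yT : y' T.+1 = ys by rewrite /y' ltnn.
rewrite xT yT in regret.
have LE : \sum_(1 <= t < T.+1) L t (x' t) (y' t)
    = \sum_(1 <= t < T.+1) Lbar t (x t) (y t)
      + \sum_(1 <= t < T.+1) 1 / eta * RX (x t)
      - \sum_(1 <= t < T.+1) 1 / eta * RY (y t).
  rewrite -big_split -sumrB/=; apply: eq_big_nat => t /andP[_ tT].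
  by rewrite /x' /y' -ltnS tT.
rewrite LE cumulative_regularized in regret.
have [ux hux] := lipschitz_wrt_argmax hNl hX0 hXcomp hRXlip.
have [vy hvy] := lipschitz_wrt_argmax hNr hY0 hYcomp hRYlip.
have RXb u : X u -> 0 <= RX u <= maximum X RX.
  by move=> Xu; rewrite hRX0// (maximumE hux) hux.2.
have RYb v : Y v -> 0 <= RY v <= maximum Y RY.
  by move=> Yv; rewrite hRY0// (maximumE hvy) hvy.2.
have := sum_scaled_bounds heta (fun t tT => RXb _ (Xx t tT)).
have := sum_scaled_bounds heta (fun t tT => RYb _ (Yy t tT)).
move: regret.
set PX := \sum_(1 <= t < _) _ * RX _; set PY := \sum_(1 <= t < _) _ * RY _.
set W := \sum_(1 <= t < _) Lbar t (x t) _.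
pose S u v := \sum_(1 <= t < T.+1) Lbar t u v.
rewrite -/(S xs ys) => regret /andP[PY0 PYM] /andP[PX0 PXM].
have SlipX v : Y v -> lipschitz_wrt (norm_l N) X (T%:R * GL) (S^~ v).
  move=> Yv; apply: lipschitz_wrt_sum => t tT.
  exact: lipschitz2_wrt_l Yv (hLlip _ tT).
have SlipY u : X u -> lipschitz_wrt (norm_r N) Y (T%:R * GL) (S u).
  move=> Xu; apply: lipschitz_wrt_sum => t tT.
  exact: lipschitz2_wrt_r Xu (hLlip _ tT).
have Smax u : X u -> argmax Y (S u) !=set0.
  by move=> Xu; exact: (lipschitz_wrt_argmax hNr hY0 hYcomp (SlipY _ Xu)).
have [um hum] : argmin X (fun u => maximum Y (S u)) !=set0.
  exact: (lipschitz_wrt_argmin hNl hX0 hXcomp (lipschitz_wrt_maximum Smax SlipX)).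
have -> : minimum X (fun u => maximum Y (fun v => \sum_(1 <= t < T.+1) Lbar t u v))
    = maximum Y (S um) by exact: minimumE hum.
have [[Xs smin] [Ys smax]] := sT.
have [Xum umin] := hum.
have Teta : 0 <= T%:R / eta by rewrite divr_ge0 ?ler0n// ltW.
have /andP[mY0 _] := RYb _ Ys.
have /andP[mX0 _] := RXb _ Xs.
(* The best reply [v] to [xs] without regularizers bounds the min-max value, and [ys] is optimal
   against [v] in the regularized game; passing between the games costs at most the maximum of
   [RY]. *)
have Fle : maximum Y (S um) <= S xs ys + T%:R / eta * RX xs - T%:R / eta * RY ys
    + T%:R / eta * maximum Y RY.
  have [v xv] := Smax _ Xs.
  apply: le_trans (umin _ Xs) _; rewrite (maximumE xv).
  have := smax _ xv.1; rewrite !cumulative_regularized -/(S xs v) -/(S xs ys).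
  have /andP[_ /(ler_wpM2l Teta)] := RYb _ xv.1.
  have := mulr_ge0 Teta mX0; lra.
(* Dually, [um] is a deviation from [xs] against [ys] in the regularized game, at the cost of the
   maximum of [RX]. *)
have leF : S xs ys + T%:R / eta * RX xs - T%:R / eta * RY ys
    - T%:R / eta * maximum X RX <= maximum Y (S um).
  have [v uv] := Smax _ Xum.
  have : S um ys <= maximum Y (S um) by rewrite (maximumE uv); exact: uv.2.
  have := smin _ Xum; rewrite !cumulative_regularized -/(S xs ys) -/(S um ys).
  have /andP[_ /(ler_wpM2l Teta)] := RXb _ Xum.
  have := mulr_ge0 Teta mY0; lra.
have ln0 : 0 <= ln T%:R :> R by rewrite ln_ge0// ler1n.
(* With modulus [1 / eta] the regret constant is [4 * eta * G ^+ 2], half of the one claimed. *)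
have GE : 4 * G ^+ 2 / (1 / eta) * (1 + ln T%:R)
    <= 8 * eta * G ^+ 2 * (1 + ln T%:R).
  rewrite ler_wpM2r ?addr_ge0// div1r invrK.
  by have := mulr_ge0 (ltW heta) (sqr_ge0 G); lra.
rewrite -/G; have := le_trans regret GE; rewrite !ler_norml => /andP[r1 r2].
(* In either direction one regularizer is charged to the payoff and the other to the value, so each
   maximum is counted once. *)
by apply/andP; split; lra.
Qed.
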